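(* Let $\cdot$ be a firm and strong right partial action of a semigroup $S$ on a set $A$. Then the triple $(A\otimes S,\delta,* )$ is an initial object in the category $\mathcal{G}(A,S,\cdot)$ of globalizations of $(A,\cdot)$ and in the category $\mathcal{G}_A(A,S,\cdot)$ of $A$-generated globalizations of $(A,\cdot)$.
   Context: A partial map $f\colon X\to Y$ is a map $Z\to Y$ with $Z\subseteq X$; $f(x)$ is defined iff $x\in Z$. All actions are right actions. A global action of $S$ on a set $B$ is a map $*\colon B\times S\to B$ with $(b*s)*t=b*(st)$; then $(B,* )$ is a global $S$-act. A partial action of $S$ on $A$ is a partial map $\cdot\colon A\times S\to A$ such that if $a\cdot s$ and $(a\cdot s)\cdot t$ are defined, then $a\cdot st$ is defined and $(a\cdot s)\cdot t=a\cdot st$. It is strong if whenever $a\cdot s$ and $a\cdot st$ are defined, $(a\cdot s)\cdot t$ is defined and $(a\cdot s)\cdot t=a\cdot st$. It is unitary if for each $a\in A$ there are $b\in A$, $s\in S$ such that $b\cdot s$ is defined and $a=b\cdot s$. Tensor product: for $(a,s),(b,t)\in A\times S$ write $(a,s)\to(b,t)$ if there is $u\in S$ such that $s=ut$ and $a\cdot u$ is defined and equals $b$. Let $\rho$ be the smallest equivalence relation on $A\times S$ containing $\to$; $A\otimes S=(A\times S)/\rho$, and $a\otimes s$ is the $\rho$-class of $(a,s)$. The rule $(a\otimes s)*t=a\otimes st$ is a well-defined global action of $S$ on $A\otimes S$. The partial action $\cdot$ is firm if it is unitary and, whenever $a\cdot s$ and $b\cdot t$ are defined and $a\cdot s=b\cdot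 t$, one has $a\otimes s=b\otimes t$ in $A\otimes S$. For firm $\cdot$, $\delta\colon A\to A\otimes S$ is the well-defined map $\delta(a)=b\otimes t$ whenever $a=b\cdot t$. A globalization of $(A,\cdot)$ is a global $S$-act $(B,* )$ together with an injective map $\iota\colon A\to B$ such that for all $a\in A,s\in S$: (G1) $a\cdot s$ is defined iff $\iota(a)*s\in\iota(A)$; (G2) if $a\cdot s$ is defined then $\iota(a\cdot s)=\iota(a)*s$. It is $A$-generated if every $b\in B$ equals $\iota(a)*s$ for some $a\in A$, $s\in S$. The category $\mathcal{G}(A,S,\cdot)$ has as objects the triples $(B,\iota,* )$ where $(B,* )$ is a globalization of $(A,\cdot)$ via $\iota$; a morphism $(B,\iota,* )\to(C,i,\circ)$ is a map $\varphi\colon B\to C$ with $\varphi(b*s)=\varphi(b)\circ s$ for all $b\in B,s\in S$, and $\varphi\iota=i$. $\mathcal{G}_A(A,S,\cdot)$ is its full subcategory on the $A$-generated globalizations. *)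

(* Defs.v *)
From Stdlib Require Import Relation_Operators.
From mathcomp Require Import all_boot.
From mathcomp Require Import boolp classical_sets.

Set Implicit Arguments.
Unset Strict Implicit.
Unset Printing Implicit Defensive.

Local Open Scope quotient_scope.
Local Open Scope group_scope.

Record category := Category {
  obj :> Type;
  hom : obj -> obj -> Type;
  idc : forall X, hom X X;
  compc : forall X Y Z, hom Y Z -> hom X Y -> hom X Z;
  compc_idl : forall X Y (f : hom X Y), compc (idc Y) f = f;
  compc_idr : forall X Y (f : hom X Y), compc f (idc X) = f;
  compcA : forall X Y Z W (h : hom Z W) (g : hom Y Z) (f : hom X Y),
    compc h (compc g f) = compc (compc h g) f }.

Definition initial (C : category) (X : C) : Prop :=
  forall Y : C, exists f : hom X Y, forall g : hom X Y, g = f.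

Definition full_subcategory (C : category) (P : C -> Prop) : category :=
  @Category {X : C | P X}
    (fun X Y => hom (sval X) (sval Y))
    (fun X => idc (sval X))
    (fun _ _ _ g f => compc g f)
    (fun _ _ f => compc_idl f)
    (fun _ _ f => compc_idr f)
    (fun _ _ _ _ h g f => compcA h g f).

Record global_act (S : semigroupType) := GlobalAct {
  gsort :> Type;
  gop : gsort -> S -> gsort;
  gopM : forall b s t, gop (gop b s) t = gop b (s * t) }.

(* [act a s = Some b] reads "[a . s] is defined and equal to [b]". *)
Record partial_action (A : Type) (S : semigroupType) := PartialAction {
  pop :> A -> S -> option A;
  popM : forall a s t b c,
    pop a s = Some b -> pop b t = Some c -> pop a (s * t) = Some c }.

Definition strong (A : Type) (S : semigroupType) (act : partial_action A S) :=
  forall a s t b c,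
    act a s = Some b -> act a (s * t) = Some c -> act b t = Some c.

Definition unitary (A : Type) (S : semigroupType) (act : partial_action A S) :=
  forall a, exists b s, act b s = Some a.

Section Tensor.
Variables (A : Type) (S : semigroupType) (act : partial_action A S).

(* [{classic A}] is [A] itself, with the choice structure that quotient types
   require. *)
Definition tensor_step (p q : {classic A} * S) : Prop :=
  exists u : S, p.2 = u * q.2 /\ act p.1 u = Some q.1.

Definition tensor_rel : rel ({classic A} * S) :=
  fun p q => `[< clos_refl_sym_trans _ tensor_step p q >].

Lemma tensor_rel_refl : reflexive tensor_rel.
Proof. by move=> p; apply/asboolP; exact: rst_refl. Qed.

Lemma tensor_rel_sym : symmetric tensor_rel.
Proof. by move=> p q; apply/asboolP/asboolP; exact: rst_sym. Qed.

Lemma tensor_rel_trans : transitive tensor_rel.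
Proof.
by move=> q p r /asboolP pq /asboolP qr; apply/asboolP; exact: rst_trans qr.
Qed.

Canonical tensor_equiv :=
  EquivRel tensor_rel tensor_rel_refl tensor_rel_sym tensor_rel_trans.

Definition tensor := {eq_quot tensor_equiv}.

Definition tens (a : A) (s : S) : tensor :=
  \pi_tensor ((a, s) : {classic A} * S).

Lemma tens_eqP a s b t :
  tens a s = tens b t <-> clos_refl_sym_trans _ tensor_step (a, s) (b, t).
Proof.
by split=> [/eqmodP/asboolP //|rst_ab]; apply/eqmodP/asboolP.
Qed.

Lemma tens_surj (x : tensor) : exists a s, x = tens a s.
Proof. by elim/quotW: x => -[a s]; exists a, s. Qed.

Definition tensor_op (x : tensor) (t : S) : tensor :=
  tens (repr x).1 ((repr x).2 * t).

Lemma tensor_opE a s t : tensor_op (tens a s) t = tens a (s * t).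
Proof.
rewrite /tensor_op; case: piP => -[b r] /eqmodP/asboolP /= rst_ab.
suff H p q : clos_refl_sym_trans _ tensor_step p q ->
    tens p.1 (p.2 * t) = tens q.1 (q.2 * t) by rewrite -(H _ _ rst_ab).
elim=> {p q} [p q [u [pE act_pq]]|//|p q _ ->//|p q r' _ -> _ ->//].
apply/tens_eqP; apply: rst_step; exists u; split => //=.
by rewrite pE mulgA.
Qed.

Lemma tensor_opM x s t : tensor_op (tensor_op x s) t = tensor_op x (s * t).
Proof. by have [a [r ->]] := tens_surj x; rewrite !tensor_opE mulgA. Qed.

Definition tensor_act : global_act S := GlobalAct tensor_opM.

Definition firm : Prop :=
  unitary act /\
  forall a s b t c, act a s = Some c -> act b t = Some c -> tens a s = tens b t.

Lemma delta_subproof (act_firm : firm) (a : A) :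
  exists x : tensor, forall b t, act b t = Some a -> x = tens b t.
Proof.
have [act_unitary act_tens] := act_firm.
have [b [s bs]] := act_unitary a.
by exists (tens b s) => c t ct; exact: act_tens bs ct.
Qed.

(* By unitarity the value chosen here is unique: see [deltaE]. *)
Definition delta (act_firm : firm) (a : A) : tensor_act :=
  sval (cid (delta_subproof act_firm a)).

Lemma deltaE (act_firm : firm) a b t :
  act b t = Some a -> delta act_firm a = tens b t.
Proof. exact: (svalP (cid (delta_subproof act_firm a))). Qed.

End Tensor.

Section Globalization.
Variables (A : Type) (S : semigroupType) (act : partial_action A S).

Definition is_globalization (B : global_act S) (iota : A -> B) : Prop :=
  [/\ injective iota,
      forall a s, isSome (act a s) <-> range iota (gop (iota a) s) &
      forall a s b, act a s = Some b -> iota b = gop (iota a) s].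

Record globalization := Globalization {
  gl_act :> global_act S;
  gl_emb : A -> gl_act;
  gl_axiom : is_globalization gl_emb }.

Definition generated (B : globalization) : Prop :=
  forall b : B, exists a s, b = gop (gl_emb B a) s.

Definition is_gl_hom (B C : globalization) (phi : B -> C) : Prop :=
  (forall b s, phi (gop b s) = gop (phi b) s) /\
  (forall a, phi (gl_emb B a) = gl_emb C a).

Definition gl_hom (B C : globalization) := {phi : B -> C | is_gl_hom phi}.

Lemma gl_hom_eq B C (f g : gl_hom B C) : sval f = sval g -> f = g.
Proof. by case: f g => [f fP] [g gP] /= fg; exact: eq_exist. Qed.

Lemma is_gl_hom_id B : @is_gl_hom B B id.
Proof. by []. Qed.

Lemma is_gl_hom_comp B C D (g : gl_hom C D) (f : gl_hom B C) :
  is_gl_hom (sval g \o sval f).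
Proof.
case: g f => [g [gM gA]] [f [fM fA]].
by split=> [b s|a] /=; rewrite ?fM ?gM ?fA ?gA.
Qed.

Definition gl_id B : gl_hom B B := exist _ id (is_gl_hom_id B).

Definition gl_comp B C D (g : gl_hom C D) (f : gl_hom B C) : gl_hom B D :=
  exist _ (sval g \o sval f) (is_gl_hom_comp g f).

Lemma gl_comp_idl B C (f : gl_hom B C) : gl_comp (gl_id C) f = f.
Proof. exact: gl_hom_eq. Qed.

Lemma gl_comp_idr B C (f : gl_hom B C) : gl_comp f (gl_id B) = f.
Proof. exact: gl_hom_eq. Qed.

Lemma gl_compA B C D E (h : gl_hom D E) (g : gl_hom C D) (f : gl_hom B C) :
  gl_comp h (gl_comp g f) = gl_comp (gl_comp h g) f.
Proof. exact: gl_hom_eq. Qed.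

Definition globalization_cat : category :=
  Category gl_comp_idl gl_comp_idr gl_compA.

Definition generated_cat : category :=
  @full_subcategory globalization_cat generated.

End Globalization.

(* Main.v *)
Require Import Defs.
From mathcomp Require Import all_boot.
From Stdlib Require Import Relation_Operators.
From mathcomp Require Import boolp classical_sets.

(** Strength together with the partial action axiom makes the partial map
    [(a, s) |-> a . s] constant along [->], so it factors through [A (x) S];
    this gives injectivity of [delta] and (G1).  Everything else rests on the
    identity [delta a * s = a (x) s], which makes [delta] generate [A (x) S] and
    forces a morphism to [(B, iota)] to send [a (x) s] to [iota a * s]. *)

Set Implicit Arguments.
Unset Strict Implicit.
Unset Printing Implicit Defensive.

Local Open Scope quotient_scope.
Local Open Scope group_scope.

Section TensorTheory.
Variables (A : Type) (S : semigroupType) (act : partial_action A S).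

Lemma tens_step a u b t : act a u = Some b -> tens act a (u * t) = tens act b t.
Proof. by move=> au; apply/tens_eqP/rst_step; exists u. Qed.

(** Universal property of the quotient: equality in [T] is itself an equivalence relation, so
    compatibility with the generating steps suffices, by induction on the closure. *)
Lemma tens_lift (T : Type) (f : A -> S -> T) :
    (forall a u b t, act a u = Some b -> f a (u * t) = f b t) ->
  forall a s b t, tens act a s = tens act b t -> f a s = f b t.
Proof.
move=> f_step a s b t /tens_eqP rst_ab.
suff H p q : clos_refl_sym_trans _ (tensor_step act) p q ->
  f p.1 p.2 = f q.1 q.2 by exact: H rst_ab.
elim=> {p q} [p q [u [-> /f_step //]]|//|p q _ ->//|p q r _ -> _ -> //].
Qed.

(** Taking [option A] as target compares definedness and values at once. *)
Lemma tens_pop : strong act ->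
  forall a s b t, tens act a s = tens act b t -> act a s = act b t.
Proof.
move=> act_strong; apply: tens_lift => a u b t au.
(* Strength carries definedness from [act a (u * t)] to [act b t]; [popM] carries it back. *)
case aut: (act a (u * t)) => [c|].
  by rewrite (act_strong _ _ _ _ _ au aut).
by case bt: (act b t) => [c|//]; rewrite (popM au bt) in aut.
Qed.

Hypothesis act_firm : firm act.

Lemma delta_op a s : gop (delta act_firm a) s = tens act a s.
Proof.
have [b [t bt]] := act_firm.1 a.
by rewrite (deltaE act_firm bt) /= tensor_opE (tens_step _ bt).
Qed.

(** Writing [a] as [c . s] by unitarity turns the left side into an equality of two tensors, to
    which [tens_pop] applies. Injectivity, (G1) and (G2) are all read off from this equivalence. *)
Lemma delta_eq_tens : strong act ->
  forall a b t, delta act_firm a = tens act b t <-> act b t = Some a.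
Proof.
move=> act_strong a b t; split=> [|bt]; last exact: deltaE.
have [c [s cs]] := act_firm.1 a.
by rewrite (deltaE act_firm cs) => /(tens_pop act_strong) <-.
Qed.

Lemma delta_globalization : strong act -> is_globalization act (delta act_firm).
Proof.
move=> act_strong; have deltaP := delta_eq_tens act_strong.
split=> [a b|a s|a s b]; rewrite ?delta_op.
- have [c [t ct]] := act_firm.1 b.
  by rewrite (deltaE act_firm ct) => /deltaP; rewrite ct => -[].
- split=> [|[b _ /deltaP ->//]].
  by case as_: (act a s) => [b|//] _; exists b => //; apply/deltaP.
- by move/deltaP.
Qed.

(** Evaluated at the chosen representative; [tensor_liftE] shows that the choice is immaterial. *)
Definition tensor_lift (B : globalization act) (x : tensor act) : B :=
  gop (gl_emb B (repr x).1) (repr x).2.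

(** By (G2) in [B], a step with [a . u = b] moves [u] across the embedding. *)
Lemma tensor_liftE (B : globalization act) a s :
  tensor_lift B (tens act a s) = gop (gl_emb B a) s.
Proof.
have [_ _ embM] := gl_axiom B.
rewrite /tensor_lift; apply: (tens_lift (f := fun a => gop (gl_emb B a))).
  by move=> {}a u b t /embM ->; rewrite gopM.
by rewrite /tens -surjective_pairing reprK.
Qed.

Variable glob : is_globalization act (delta act_firm).

Lemma delta_generated : generated (Globalization glob).
Proof.
by move=> x; have [a [s ->]] := tens_surj x; exists a, s; rewrite /= -delta_op.
Qed.

Lemma tensor_lift_hom (B : globalization act) :
  @is_gl_hom _ _ _ (Globalization glob) B (tensor_lift B).
Proof.
have [_ _ embM] := gl_axiom B.
split=> [x t|a] /=.
  have [a [s ->]] := tens_surj x.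
  by rewrite tensor_opE !tensor_liftE gopM.
have [b [t bt]] := act_firm.1 a.
by rewrite (deltaE act_firm bt) tensor_liftE (embM _ _ _ bt).
Qed.

(** A morphism is prescribed on the image of [delta], and the translates of that image exhaust the
    tensor product. *)
Lemma tensor_lift_unique (B : globalization act)
    (g : gl_hom (Globalization glob) B) : sval g = tensor_lift B.
Proof.
case: g => g [gM gA]; apply/funext => x /=.
have [a [s ->]] := tens_surj x.
by rewrite tensor_liftE -gA -gM /= -delta_op.
Qed.

Lemma delta_initial : initial (C := globalization_cat act) (Globalization glob).
Proof.
move=> B; exists (exist _ _ (tensor_lift_hom B)) => g.
exact/gl_hom_eq/tensor_lift_unique.
Qed.

End TensorTheory.

(** Hom types of the subcategory are those of [C] by conversion, so the same unique morphism
    serves. *)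
Lemma initial_full_subcategory (C : category) (P : C -> Prop) (X : C)
    (PX : P X) :
  initial X -> initial (C := full_subcategory P) (exist _ X PX).
Proof. by move=> X_initial [Y PY]; exact: X_initial. Qed.

Theorem corollary3p6 (A : Type) (S : semigroupType) (act : partial_action A S)
    (act_firm : firm act) (act_strong : strong act) :
  exists glob : is_globalization act (delta act_firm),
    initial (C := globalization_cat act) (Globalization glob) /\
    exists gen : generated (Globalization glob),
      initial (C := generated_cat act) (exist _ (Globalization glob) gen).
Proof.
exists (delta_globalization act_firm act_strong); split.
  exact: delta_initial.
exists (@delta_generated _ _ _ _ _).
exact/initial_full_subcategory/delta_initial.
Qed.
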